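(* Let $d,n\ge1$ be integers, let $\hat c=[\hat c_{\boldsymbol k}\mid\boldsymbol k\in\Omega]$ be a sequence of complex numbers with $\hat c_{-\boldsymbol k}=\overline{\hat c_{\boldsymbol k}}$, and let $\mathcal{T}_d$ be the associated $(n+1)^d\times(n+1)^d$ moment matrix, whose entries are the elements of $\hat c$. Then $\mathcal{T}_d\succ0$ if and only if $\hat c\in\mathfrak{C}_+$.
   Context: $\Omega=\{(k_1,\dots,k_d)\in\mathbb{Z}^d:|k_j|\le n\}$, $\Omega_+=\{(k_1,\dots,k_d)\in\mathbb{Z}^d:0\le k_j\le n\}$, $\boldsymbol\theta\in(-\pi,\pi]^d$, $(\boldsymbol k,\boldsymbol\theta)=\sum_jk_j\theta_j$. $K(e^{i\boldsymbol\theta})=K(e^{i\theta_1})\otimes\cdots\otimes K(e^{i\theta_d})$ with $K(e^{i\theta_k})=[1,e^{i\theta_k},\dots,e^{in\theta_k}]^\top$ (Kronecker product). $\mathcal{T}_d$ has entry $\hat c_{\boldsymbol k}$ in each position $(i,j)$ where $K_i\bar K_j=e^{i(\boldsymbol k,\boldsymbol\theta)}$ (so the formal relation is $\mathcal{T}_d=\int K\Phi K^H dm$ when $\hat c_{\boldsymbol k}=\int e^{i(\boldsymbol k,\boldsymbol\theta)}\Phi\,dm$). $\succ0$ means Hermitian positive definite. The open convex cone $\mathfrak{C}_+$ is the set of sequences $c=[c_{\boldsymbol k}\mid\boldsymbol k\in\Omega]$ such that $\langle c,r^*r\rangle>0$ for all nonzero $r=\sum_{\boldsymbol k\in\Omega_+}r_{\boldsymbol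 k}e^{-i(\boldsymbol k,\boldsymbol\theta)}$ (coefficient vector in $\mathbb{C}^{(n+1)^d}\setminus\{0\}$), where $r^*=\sum_{\boldsymbol k\in\Omega_+}\bar r_{\boldsymbol k}e^{i(\boldsymbol k,\boldsymbol\theta)}$ and, for a trigonometric polynomial $p=\sum_{\boldsymbol k\in\Omega}p_{\boldsymbol k}e^{-i(\boldsymbol k,\boldsymbol\theta)}$, $\langle c,p\rangle=\sum_{\boldsymbol k\in\Omega}c_{\boldsymbol k}\bar p_{\boldsymbol k}$. *)

(* Defs.v *)
From HB Require Import structures.
From mathcomp Require Import all_boot all_order all_algebra.
From mathcomp Require Import boolp reals trigo complex mxtens zify.

Set Implicit Arguments.
Unset Strict Implicit.
Unset Printing Implicit Defensive.

Import Order.TTheory GRing.Theory Num.Theory.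
Local Open Scope ring_scope.

Record zrange (n : nat) := ZRange {
  zval :> int;
  zvalP : `|zval| <= n%:Z :> int }.

HB.instance Definition _ n := [isSub for @zval n].
HB.instance Definition _ n := [Countable of zrange n by <:].

Section ZrangeFinite.
Variable n : nat.

Let code (x : zrange n) : 'I_(2 * n).+1 := inord (absz (zval x + n%:Z)).
Let decode (i : 'I_(2 * n).+1) : option (zrange n) := insub (i%:Z - n%:Z).

Let codeK : pcancel code decode.
Proof.
case=> x hx; rewrite /code /decode /=.
have /andP[h1 h2] : - n%:Z <= x <= n%:Z by rewrite -ler_norml.
have h0 : 0 <= x + n%:Z by rewrite -lerBlDr add0r.
rewrite inordK; last first.
  by rewrite ltnS -lez_nat gez0_abs // mul2n -addnn PoszD lerD2r.
by rewrite gez0_abs // addrK insubT.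
Qed.

HB.instance Definition _ := isFinite.Build (zrange n) (pcan_enumP codeK).
End ZrangeFinite.

Lemma zopp_subproof n (x : zrange n) : `|- zval x| <= n%:Z.
Proof. by rewrite normrN zvalP. Qed.

Definition zopp n (x : zrange n) : zrange n := ZRange (zopp_subproof x).

Definition Omega (d n : nat) := {ffun 'I_d -> zrange n}.

Definition Omega_plus (d n : nat) := {ffun 'I_d -> 'I_n.+1}.

Definition Omega_opp d n (k : Omega d n) : Omega d n := [ffun j => zopp (k j)].

Section Trigonometric.
Variable R : realType.
Implicit Types d n : nat.

Definition expi (t : R) : R[i] := (cos t +i* sin t)%C.

Lemma expi0 : expi (0 : R) = 1.
Proof. by rewrite /expi cos0 sin0. Qed.

Lemma expiD (s t : R) : expi (s + t) = expi s * expi t.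
Proof.
by rewrite /expi cosD sinD; apply/eqP; rewrite eq_complex /= eqxx addrC eqxx.
Qed.

Lemma expi_conj (t : R) : (expi t)^* = expi (- t).
Proof. by rewrite /expi cosN sinN. Qed.

Lemma expi_inj (s t : R) : `|s - t| <= pi -> expi s = expi t -> s = t.
Proof.
move=> hst [hc hs]; apply/eqP; rewrite -subr_eq0 -normr_eq0; apply/eqP.
apply: (@cos_inj R); rewrite ?in_itv /= ?lexx ?pi_ge0 ?normr_ge0 //.
have -> : cos `|s - t| = cos (s - t) by case: (ler0P (s - t)); rewrite ?cosN.
by rewrite cosB hc hs cos0 -!expr2 cos2Dsin2.
Qed.

Definition torus d (theta : 'I_d -> R) : Prop :=
  forall j, - pi < theta j <= pi.

Definition pairing d (k : 'I_d -> int) (theta : 'I_d -> R) : R :=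
  \sum_j (k j)%:~R * theta j.

Definition multi_index_plus d n (k : Omega_plus d n) : 'I_d -> int :=
  fun j => (k j)%:Z.

Definition multi_index d n (k : Omega d n) : 'I_d -> int :=
  fun j => zval (k j).

Definition vecK1 n (t : R) : 'cV[R[i]]_n.+1 := \col_(l < n.+1) expi (l%:R * t).

(* The Kronecker product v_0 (x) v_1 (x) ... (x) v_(d-1), with the empty product
   equal to the 1 x 1 matrix 1; the casts identify m ^ d.+1 with m * m ^ d and
   the column count 1 * 1 with 1. *)
Fixpoint kron (m d : nat) : ('I_d -> 'cV[R[i]]_m) -> 'cV[R[i]]_(m ^ d) :=
  match d with
  | 0 => fun _ => 1%:M
  | d'.+1 => fun v =>
      castmx (esym (expnS m d'), muln1 1)
        (v ord0 *t kron (fun j => v (lift ord0 j)))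
  end.

Definition vecK d n (theta : 'I_d -> R) : 'cV[R[i]]_(n.+1 ^ d) :=
  kron (fun j => vecK1 n (theta j)).

Definition entry_index d n (i j : 'I_(n.+1 ^ d)) (k : Omega d n) : Prop :=
  forall theta : 'I_d -> R, torus theta ->
    vecK n theta i 0 * (vecK n theta j 0)^* =
      expi (pairing (multi_index k) theta).

Lemma vecK_entry d n (i : 'I_(n.+1 ^ d)) :
  exists a : Omega_plus d n, forall theta : 'I_d -> R,
    vecK n theta i 0 = expi (pairing (multi_index_plus a) theta).
Proof.
elim: d i => [|d IH] i.
  exists [ffun=> ord0] => theta.
  rewrite /vecK /= /pairing big_ord0 expi0 mxE.
  by rewrite (ord1 (i : 'I_1)).
have [u [v def_i]] : exists u v, cast_ord (expnS n.+1 d) i = mxtens_index (u, v).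
  by case: (mxtens_indexP (cast_ord (expnS n.+1 d) i)) => u v; exists u, v.
case: (IH v) => a ha.
exists [ffun j => if unlift ord0 j is Some j' then a j' else u] => theta.
rewrite /vecK /= castmxE /= esymK def_i.
set z := cast_ord _ _.
have -> : z = mxtens_index (0, 0) by apply/val_inj.
rewrite tensmxE mxE -/(vecK n (fun j => theta (lift ord0 j))) ha -expiD.
congr expi; rewrite /pairing big_ord_recl /multi_index_plus ffunE unlift_none.
by congr (_ + _); apply: eq_bigr => j _; rewrite ffunE liftK.
Qed.

Lemma entry_index_exists d n (i j : 'I_(n.+1 ^ d)) :
  exists k : Omega d n, entry_index i j k.
Proof.
have [a ha] := vecK_entry i; have [b hb] := vecK_entry j.
have hk l : `|(a l)%:Z - (b l)%:Z| <= n%:Z.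
  have := ltn_ord (a l); have := ltn_ord (b l); rewrite !ltnS => h1 h2.
  by rewrite ler_norml; apply/andP; lia.
exists [ffun l => ZRange (hk l)] => theta _.
rewrite ha hb expi_conj -expiD; congr expi.
rewrite /pairing -sumrN -big_split; apply: eq_bigr => l _ /=.
by rewrite /multi_index_plus /multi_index ffunE /= rmorphB mulrBl.
Qed.

Lemma entry_index_unique d n (i j : 'I_(n.+1 ^ d)) (k l : Omega d n) :
  entry_index i j k -> entry_index i j l -> k = l.
Proof.
move=> hk hl; apply/ffunP => m; apply: val_inj => /=.
pose t : R := pi / (2 * n).+1%:R.
have t_gt0 : 0 < t by rewrite /t divr_gt0 ?pi_gt0 ?ltr0n.
have t_le : t * (2 * n).+1%:R = pi by rewrite /t divfK ?pnatr_eq0.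
pose theta (j : 'I_d) : R := if j == m then t else 0.
have htheta : torus theta.
  move=> q; rewrite /theta; case: ifP => _; have p0 := pi_gt0 R.
    rewrite (lt_trans _ t_gt0) ?oppr_lt0 //= -t_le ler_peMr ?ler1n //.
    exact: ltW.
  by rewrite oppr_lt0 p0 ltW.
have pE (x : Omega d n) : pairing (multi_index x) theta = (zval (x m))%:~R * t.
  rewrite /pairing (bigD1 m) //= {1}/theta eqxx big1 ?addr0 // => q /negbTE qm.
  by rewrite /theta qm mulr0.
have := hl theta htheta; rewrite (hk theta htheta) !pE => /expi_inj e.
apply: (@intr_inj R); apply: (mulIf (lt0r_neq0 t_gt0)); apply: e.
rewrite -mulrBl normrM (gtr0_norm t_gt0) -t_le mulrC ler_pM2l //.
rewrite -rmorphB /= -intr_norm -[leRHS]/((2 * n).+1%:~R) ler_int.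
apply: le_trans (ler_normB _ _) _; have := zvalP (k m); have := zvalP (l m).
lia.
Qed.

(* For all i and j exactly one k satisfies entry_index i j k, so the default
   value 0 is never used. *)
Definition moment_matrix d n (c : {ffun Omega d n -> R[i]}) :
    'M[R[i]]_(n.+1 ^ d) :=
  \matrix_(i, j)
    if [pick k : Omega d n | `[< entry_index i j k >]] is Some k
    then c k else 0.

Lemma moment_matrixE d n (c : {ffun Omega d n -> R[i]}) i j k :
  entry_index i j k -> moment_matrix c i j = c k.
Proof.
move=> hk; rewrite mxE; case: pickP => [l /asboolP hl|/(_ k)].
  by rewrite (entry_index_unique hl hk).
by move/asboolP: hk => ->.
Qed.

Definition posdefmx N (A : 'M[R[i]]_N) : Prop :=
  A \is hermsymmx /\
  forall x : 'cV[R[i]]_N, x != 0 ->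
    0 < (map_mx Num.conj x^T *m A *m x) 0 0.

Definition trigpoly d n (p : {ffun Omega d n -> R[i]}) (theta : 'I_d -> R) :
    R[i] :=
  \sum_k p k * expi (- pairing (multi_index k) theta).

Definition trigpoly_plus d n (r : {ffun Omega_plus d n -> R[i]})
    (theta : 'I_d -> R) : R[i] :=
  \sum_k r k * expi (- pairing (multi_index_plus k) theta).

Definition trigpoly_star d n (r : {ffun Omega_plus d n -> R[i]})
    (theta : 'I_d -> R) : R[i] :=
  \sum_k (r k)^* * expi (pairing (multi_index_plus k) theta).

Definition bracket d n (c p : {ffun Omega d n -> R[i]}) : R[i] :=
  \sum_k c k * (p k)^*.

(* <c, r^* r> is the bracket of c with the coefficients p of the trigonometric
   polynomial r^* r, i.e. p k = \sum_(l - m = k) r l * (r m)^*; they exist and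
   are determined by that function, so the quantification over p is neither
   vacuous nor ambiguous.  In the order of R[i], 0 < z means that z is real and
   positive. *)
Definition C_plus d n (c : {ffun Omega d n -> R[i]}) : Prop :=
  forall r : {ffun Omega_plus d n -> R[i]}, r != 0 ->
  forall p : {ffun Omega d n -> R[i]},
    (forall theta, torus theta ->
       trigpoly p theta = trigpoly_star r theta * trigpoly_plus r theta) ->
    0 < bracket c p.

End Trigonometric.

(* Main.v *)
Require Import Defs.
From HB Require Import structures.
From mathcomp Require Import all_boot all_order all_algebra.
From mathcomp Require Import boolp reals trigo complex mxtens zify ring lra.

Set Implicit Arguments.
Unset Strict Implicit.
Unset Printing Implicit Defensive.

Import Order.TTheory GRing.Theory Num.Theory.
Local Open Scope ring_scope.

(** Both conditions say that one and the same Hermitian form is positive.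
    Each row of the Kronecker vector [K] is a character [expi (a, theta)] with
    [a] in [Omega_plus], and every such [a] labels exactly one row
    ([row_bijection]); the entry of the moment matrix at the rows labelled [a]
    and [b] is therefore [c (a - b)].  Hence, with [x] at row [a] written
    [r a], the quadratic form of the moment matrix at [x] is
      [\sum_a \sum_b c (a - b) (r a)^* r b]
    ([quadratic_form_moment]).  Multiplying out, [r^* r] has the coefficients
    [p k = \sum_(a - b = k) r a (r b)^*], so [<c, r^* r>] is the same double sum
    ([bracket_autocorrelation]), and the nonzero [x] correspond to the nonzero
    [r].

    The bracket is computed from a coefficient family of the function [r^* r],
    so the family above must be the only one: trigonometric polynomials with
    frequencies in [Omega] that agree on the torus have equal coefficients
    ([trigpoly_inj]).  This follows from discrete Fourier inversion on a grid
    with [2 n + 1] nodes in each coordinate, a number larger than [|k_j - l_j|]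
    for all [k], [l] in [Omega], so that distinct characters remain orthogonal
    on the grid. *)

(** * Rows of the Kronecker vector and entries of the moment matrix *)

Lemma dist_ord_le n (a b : 'I_n.+1) : `|a%:Z - b%:Z| <= n%:Z.
Proof.
have := ltn_ord a; have := ltn_ord b; rewrite !ltnS => h1 h2.
by rewrite ler_norml; apply/andP; lia.
Qed.

Definition index_sub {d n} (a b : Omega_plus d n) : Omega d n :=
  [ffun j => ZRange (dist_ord_le (a j) (b j))].

Lemma index_sub_opp d n (a b : Omega_plus d n) :
  Omega_opp (index_sub a b) = index_sub b a.
Proof. by apply/ffunP => j; rewrite !ffunE; apply: val_inj; rewrite /= opprB. Qed.

Lemma index_sub_eq0 d n (a b : Omega_plus d n) :
  index_sub a b = index_sub a a -> a = b.
Proof.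
move=> /ffunP e; apply/ffunP => j; apply/val_inj.
by have := congr1 (@zval n) (e j); rewrite !ffunE /=; lia.
Qed.

Lemma pairing_index_sub (R : realType) d n (a b : Omega_plus d n)
    (theta : 'I_d -> R) :
  pairing (multi_index (index_sub a b)) theta =
  pairing (multi_index_plus a) theta - pairing (multi_index_plus b) theta.
Proof.
rewrite /pairing -sumrN -big_split; apply: eq_bigr => j _ /=.
by rewrite /multi_index_plus /multi_index ffunE /= rmorphB mulrBl.
Qed.

(** The mixed-radix digits of a row number are the exponents, so any exponents
    are realised: peel off the first tensor factor and recurse on the rest. *)
Lemma vecK_row (R : realType) d n (a : Omega_plus d n) :
  exists i : 'I_(n.+1 ^ d), forall theta : 'I_d -> R,
    vecK n theta i 0 = expi (pairing (multi_index_plus a) theta).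
Proof.
elim: d a => [|d IH] a.
  exists ord0 => theta.
  by rewrite /vecK /= /pairing big_ord0 expi0 mxE.
have [i hi] := IH [ffun j => a (lift ord0 j)].
exists (cast_ord (esym (expnS n.+1 d)) (mxtens_index (a ord0, i))) => theta.
rewrite /vecK /= castmxE /= esymK cast_ordKV.
set z := cast_ord _ _.
have -> : z = mxtens_index (0, 0) by apply/val_inj.
rewrite tensmxE mxE -/(vecK n (fun j => theta (lift ord0 j))) hi -expiD.
congr expi; rewrite /pairing big_ord_recl.
by congr (_ + _); apply: eq_bigr => j _; rewrite /multi_index_plus ffunE.
Qed.

Lemma entry_index_sub (R : realType) d n (a b : Omega_plus d n)
    (i j : 'I_(n.+1 ^ d)) :
  (forall theta : 'I_d -> R,
    vecK n theta i 0 = expi (pairing (multi_index_plus a) theta)) ->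
  (forall theta : 'I_d -> R,
    vecK n theta j 0 = expi (pairing (multi_index_plus b) theta)) ->
  entry_index R i j (index_sub a b).
Proof.
by move=> hi hj theta _; rewrite hi hj expi_conj -expiD pairing_index_sub.
Qed.

(** Injectivity comes from the uniqueness of the frequency of an entry: if [a]
    and [b] labelled the same row, the diagonal entry there would have both
    frequencies [a - a] and [a - b].  Bijectivity then follows by counting. *)
Lemma row_bijection (R : realType) d n :
  exists2 f : Omega_plus d n -> 'I_(n.+1 ^ d), bijective f &
    forall a b, entry_index R (f a) (f b) (index_sub a b).
Proof.
have [f hf] := choice (@vecK_row R d n).
have fE a b := entry_index_sub (hf a) (hf b).
exists f => //; apply: inj_card_bij => [a b e|]; last first.
  by rewrite card_ffun !card_ord.
apply: index_sub_eq0; apply: (entry_index_unique (R := R)) (fE a a).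
by rewrite {2}e; apply: fE.
Qed.

(** Exchanging two rows negates the frequency of the entry, and [c] is
    conjugate symmetric. *)
Lemma moment_matrix_herm (R : realType) d n (c : {ffun Omega d n -> R[i]}) :
  (forall k, c (Omega_opp k) = (c k)^*) -> moment_matrix c \is hermsymmx.
Proof.
move=> hc; have [f [g fK gK] fE] := @row_bijection R d n.
apply/is_hermitianmxP; rewrite expr0 scale1r; apply/matrixP => i j.
rewrite [RHS]mxE [X in _ = _ X]mxE.
rewrite -(gK i) -(gK j) (moment_matrixE c (fE (g i) (g j))).
by rewrite (moment_matrixE c (fE (g j) (g i))) /= -hc index_sub_opp.
Qed.

Lemma quadratic_form_moment (R : realType) d n (c : {ffun Omega d n -> R[i]})
    (f : Omega_plus d n -> 'I_(n.+1 ^ d)) (x : 'cV[R[i]]_(n.+1 ^ d)) :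
  bijective f -> (forall a b, entry_index R (f a) (f b) (index_sub a b)) ->
  (map_mx Num.conj x^T *m moment_matrix c *m x) 0 0 =
  \sum_a \sum_b c (index_sub a b) * ((x (f a) 0)^* * x (f b) 0).
Proof.
move=> bf fE; rewrite exchange_big /= mxE (reindex f) /=; last exact: onW_bij.
apply: eq_bigr => b _; rewrite mxE (reindex f) /=; last exact: onW_bij.
rewrite mulr_suml; apply: eq_bigr => a _; rewrite (moment_matrixE c (fE a b)).
by rewrite !mxE; ring.
Qed.

(** * Coefficients of a squared modulus *)

(** The coefficients of [r^* r], found by multiplying out and collecting the
    pairs of indices with the same difference. *)
Definition autocorrelation {R : realType} {d n}
    (r : {ffun Omega_plus d n -> R[i]}) : {ffun Omega d n -> R[i]} :=
  [ffun k => \sum_(ab | index_sub ab.1 ab.2 == k) r ab.1 * (r ab.2)^*].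

(** Common to the evaluation of [r^* r] and to the bracket: summing against
    the coefficients regroups the pairs of indices by their difference. *)
Lemma sum_autocorrelation (R : realType) d n
    (r : {ffun Omega_plus d n -> R[i]}) (F : Omega d n -> R[i]) :
  \sum_k autocorrelation r k * F k =
  \sum_a \sum_b r a * (r b)^* * F (index_sub a b).
Proof.
rewrite pair_big /= (partition_big (fun ab => index_sub ab.1 ab.2) predT) //=.
apply: eq_bigr => k _; rewrite ffunE mulr_suml.
by apply: eq_bigr => ab /eqP ->.
Qed.

Lemma trigpoly_autocorrelation (R : realType) d n
    (r : {ffun Omega_plus d n -> R[i]}) (theta : 'I_d -> R) :
  trigpoly (autocorrelation r) theta =
  trigpoly_star r theta * trigpoly_plus r theta.
Proof.
rewrite /trigpoly sum_autocorrelation mulrC /trigpoly_plus mulr_suml.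
apply: eq_bigr => a _; rewrite /trigpoly_star mulr_sumr.
apply: eq_bigr => b _; rewrite pairing_index_sub opprB addrC expiD; ring.
Qed.

Lemma bracket_autocorrelation (R : realType) d n (c : {ffun Omega d n -> R[i]})
    (r : {ffun Omega_plus d n -> R[i]}) :
  bracket c (autocorrelation r) =
  \sum_a \sum_b c (index_sub a b) * ((r a)^* * r b).
Proof.
(* the bracket conjugates the coefficients, so conjugate the whole sum *)
rewrite /bracket -[LHS]conjCK rmorph_sum.
under eq_bigr do rewrite rmorphM /= conjCK mulrC.
rewrite (sum_autocorrelation r (fun k => (c k)^*)) rmorph_sum.
apply: eq_bigr => a _; rewrite rmorph_sum; apply: eq_bigr => b _.
by rewrite !rmorphM /= !conjCK mulrC.
Qed.

(** * Uniqueness of the coefficients *)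

Lemma expi_sum (R : realType) (I : finType) (F : I -> R) :
  expi (\sum_i F i) = \prod_i expi (F i).
Proof. by apply: (big_morph _ (@expiD R) (expi0 R)). Qed.

Lemma expi_mulrn (R : realType) (t : R) m : expi (m%:R * t) = expi t ^+ m.
Proof.
elim: m => [|m IH]; first by rewrite mul0r expi0.
by rewrite -addn1 natrD mulrDl mul1r expiD IH exprD expr1.
Qed.

Lemma expi_2pi (R : realType) : expi (2 * pi : R) = 1.
Proof. by rewrite mulr_natl /expi cos2pi sin2pi. Qed.

Lemma expi_int_2pi (R : realType) (q : int) : expi (q%:~R * (2 * pi) : R) = 1.
Proof.
have e m : expi (m%:R * (2 * pi) : R) = 1 by rewrite expi_mulrn expi_2pi expr1n.
case: (intP q) => [|m|m]; rewrite ?mul0r ?expi0 ?e //.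
by rewrite mulrNz mulNr -expi_conj e conjC1.
Qed.

(** The bound doubles the range of [expi_inj]: beyond [pi] one turn is
    subtracted first. *)
Lemma expi_eq1 (R : realType) (s : R) : `|s| < 2 * pi -> expi s = 1 -> s = 0.
Proof.
wlog s0 : s / 0 <= s => [H|].
  case: (lerP 0 s) => [|s0] hs e; first by move=> h; apply: H.
  apply/oppr_inj; rewrite oppr0; apply: H; first by rewrite oppr_ge0 ltW.
    by rewrite normrN.
  by rewrite -expi_conj e conjC1.
rewrite ger0_norm // => s2 e; have p0 := pi_gt0 R.
have [sp|sp] := lerP s pi.
  by apply: expi_inj; rewrite ?expi0 // subr0 ger0_norm.
have : s - 2 * pi = 0; last lra.
apply: expi_inj; first by rewrite subr0 ler_norml; apply/andP; lra.
by rewrite expiD e mul1r -expi_conj expi_2pi conjC1 expi0.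
Qed.

(** The equidistant points of the circle in the form that lies in the half-open
    interval from [- pi] (excluded) to [pi] (included), hence the successor. *)
Definition node (R : realType) N (m : 'I_N) : R :=
  2 * pi / N%:R * m.+1%:R - pi.

Lemma node_torus (R : realType) d N (m : 'I_d -> 'I_N) :
  torus (fun j => node R (m j)).
Proof.
move=> j; rewrite /node; have p0 := pi_gt0 R.
have N0 : (0 < N)%N by rewrite (leq_ltn_trans _ (ltn_ord (m j))).
rewrite ltrDr mulr_gt0 ?divr_gt0 ?mulr_gt0 ?ltr0n //=.
rewrite lerBlDr -mulrA -mulr2n -[leRHS]mulr_natl ler_piMr ?mulr_ge0 ?pi_ge0 //.
by rewrite mulrC ler_pdivrMr ?ltr0n // mul1r ler_nat.
Qed.

(** For [q] nonzero this is, up to a unit factor, a geometric sum of ratio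
    [z = expi (q (2 pi / N))]; here [z ^+ N = 1], and [z] differs from 1 because
    [|q| < N] makes its angle shorter than a full turn. *)
Lemma sum_node (R : realType) N (q : int) : (absz q < N)%N ->
  \sum_(m < N) expi (q%:~R * node R m) = if q == 0 then N%:R else 0.
Proof.
case: eqP => [->|/eqP q0] qN.
  under eq_bigr do rewrite mul0r expi0.
  by rewrite sumr_const card_ord.
have N0 : N%:R != 0 :> R by rewrite pnatr_eq0 -lt0n (leq_ltn_trans _ qN).
set t : R := 2 * pi / N%:R; pose z := expi (q%:~R * t).
have zN : z ^+ N = 1.
  rewrite -expi_mulrn -(@expi_int_2pi R q); congr expi.
  by rewrite /t; field.
have z1 : z != 1.
  apply/eqP => /expi_eq1 h; have : q%:~R * t = 0.
    apply: h; rewrite normrM -intr_norm /t.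
    have t0 : 0 < 2 * pi / N%:R :> R.
      by rewrite divr_gt0 ?mulr_gt0 ?pi_gt0 ?ltr0n // (leq_ltn_trans _ qN).
    rewrite (gtr0_norm t0) mulrCA gtr_pMr ?mulr_gt0 ?pi_gt0 //.
    by rewrite ltr_pdivrMr ?mul1r ?ltr0n ?(leq_ltn_trans _ qN) // -abszE ltr_nat.
  apply/eqP; rewrite mulf_neq0 ?intr_eq0 // /t.
  by rewrite mulf_neq0 ?invr_eq0 // mulf_neq0 ?pnatr_eq0 // gt_eqF ?pi_gt0.
have zE (m : 'I_N) : expi (q%:~R * node R m) = expi (q%:~R * (t - pi)) * z ^+ m.
  rewrite /z -expi_mulrn -expiD; congr expi.
  by rewrite /node -/t -natr1; ring.
rewrite (eq_bigr _ (fun m _ => zE m)) -mulr_sumr.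
suff -> : \sum_(m < N) z ^+ m = 0 by rewrite mulr0.
apply: (mulfI (x := z - 1)); first by rewrite subr_eq0.
by rewrite -subrX1 zN subrr mulr0.
Qed.

(** Discrete Fourier inversion: on the product grid the sum of a product of
    characters factors over the coordinates, and a coordinate in which the
    frequencies differ contributes the factor 0. *)
Lemma trigpoly_coef (R : realType) d n (p : {ffun Omega d n -> R[i]})
    (k : Omega d n) (N := (2 * n).+1) :
  \sum_(m : {ffun 'I_d -> 'I_N})
     trigpoly p (fun j => node R (m j)) *
     expi (pairing (multi_index k) (fun j => node R (m j))) =
  N%:R ^+ d * p k.
Proof.
under eq_bigr do rewrite mulr_suml.
rewrite exchange_big /=.
have charE l : \sum_(m : {ffun 'I_d -> 'I_N})
    expi (- pairing (multi_index l) (fun j => node R (m j))) *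
    expi (pairing (multi_index k) (fun j => node R (m j))) =
    if l == k then N%:R ^+ d else 0.
  pose q j := zval (k j) - zval (l j).
  have qN j : (absz (q j) < N)%N.
    by rewrite /N /q; have := zvalP (k j); have := zvalP (l j); lia.
  transitivity (\prod_j \sum_(m < N) expi ((q j)%:~R * node R m)).
    rewrite bigA_distr_bigA; apply: eq_bigr => m _.
    rewrite -expiD -expi_sum /pairing addrC -sumrB; congr expi.
    by apply: eq_bigr => j _; rewrite -mulrBl -rmorphB.
  under eq_bigr do rewrite sum_node //.
  have [lk|lk] := eqVneq l k.
    under eq_bigr do rewrite /q lk subrr eqxx.
    by rewrite prodr_const card_ord.
  have [j qj] : exists j, q j != 0.
    apply/existsP; apply: contraNT lk; rewrite negb_exists => /forallP h.
    apply/eqP/ffunP => j; apply/val_inj/esym/eqP => /=.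
    by rewrite -subr_eq0; have := h j; rewrite negbK.
  by rewrite (bigD1 j) //= (negbTE qj) mul0r.
transitivity (\sum_l p l * (if l == k then N%:R ^+ d else 0)).
  apply: eq_bigr => l _; rewrite -charE mulr_sumr.
  by apply: eq_bigr => m _; rewrite mulrA.
rewrite (bigD1 k) //= eqxx big1 ?addr0 => [|l /negbTE ->]; first exact: mulrC.
by rewrite mulr0.
Qed.

Lemma trigpoly_inj (R : realType) d n (p q : {ffun Omega d n -> R[i]}) :
  (forall theta, torus theta -> trigpoly p theta = trigpoly q theta) -> p = q.
Proof.
move=> pq; apply/ffunP => k.
have N0 : (2 * n).+1%:R ^+ d != 0 :> R[i] by rewrite expf_neq0 ?pnatr_eq0.
apply: (mulfI N0); rewrite -!trigpoly_coef.
by apply: eq_bigr => m _; rewrite pq //; apply: node_torus.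
Qed.

Theorem propositionV1 (R : realType) (d n : nat) (hd : (1 <= d)%N)
    (hn : (1 <= n)%N) (c : {ffun Omega d n -> R[i]})
    (hc : forall k, c (Omega_opp k) = (c k)^*) :
  posdefmx (moment_matrix c) <-> C_plus c.
Proof.
have [f bf fE] := @row_bijection R d n; have [g fK gK] := bf.
split=> [[_ pos] r r0 p hp|pos].
  have -> : p = autocorrelation r.
    by apply: trigpoly_inj => th hth; rewrite hp // trigpoly_autocorrelation.
  pose x : 'cV[R[i]]_(n.+1 ^ d) := \col_i r (g i).
  have x0 : x != 0.
    apply: contraNneq r0 => /matrixP e; apply/eqP/ffunP => a.
    by have := e (f a) 0; rewrite !mxE fK ffunE.
  have := pos x x0; rewrite (quadratic_form_moment c x bf fE) bracket_autocorrelation.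
  by congr (_ < _); apply: eq_bigr => a _; apply: eq_bigr => b _; rewrite !mxE !fK.
split=> [|x x0]; first exact: moment_matrix_herm.
pose r : {ffun Omega_plus d n -> R[i]} := [ffun a => x (f a) 0].
have r0 : r != 0.
  apply: contraNneq x0 => /ffunP e; apply/eqP/matrixP => i j.
  by have := e (g i); rewrite !ffunE gK ord1 mxE.
have := pos r r0 _ (fun th _ => trigpoly_autocorrelation r th).
rewrite (quadratic_form_moment c x bf fE) bracket_autocorrelation.
by congr (_ < _); apply: eq_bigr => a _; apply: eq_bigr => b _; rewrite !ffunE.
Qed.
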